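(* The group $G=BS(1,2)=\langle a,t \mid tat^{-1}=a^2\rangle$ is not $P(2)$ with respect to the generating set $A=\{a,a^{-1},t,t^{-1}\}$.
   Context: For a group $G$ with finite generating set $A$, let $\Gamma$ be the corresponding Cayley graph, regarded as a metric graph with path metric $d$ (each edge has length 1), and let $S(r)$ and $B(r)$ denote the sphere and the (closed) ball of radius $r$ in $\Gamma$ centred at the identity vertex. For a function $f:\mathbb{N}\to\mathbb{R}_+$ and $r_0\in\mathbb{N}$, the pair $(G,A)$ satisfies the condition $AC_{f,r_0}$ if for every natural number $r\ge r_0$ and every pair of vertices $a,b\in S(r)$ with $d(a,b)\le 2$ there is a path inside $B(r)$ from $a$ to $b$ of length at most $f(r)$. A function $f:\mathbb{N}\to\mathbb{R}_+$ is called sublinear if for every number $C>0$ one has $\lim_{r\to\infty}(r-Cf(r))=\infty$. The pair $(G,A)$ satisfies (Poénaru's) condition $P(2)$, or ''is $P(2)$'', if $AC_{f,r_0}$ holds for some sublinear function $f:\mathbb{N}\to\mathbb{R}_+$ and some $r_0\in\mathbb{N}$. *)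

(* Defs.v *)
From HB Require Import structures.
From mathcomp Require Import all_boot all_order all_algebra.
From mathcomp Require Import all_classical all_reals all_analysis.
Import numFieldNormedType.Exports.

Set Implicit Arguments.
Unset Strict Implicit.
Unset Printing Implicit Defensive.
Import Order.TTheory GRing.Theory Num.Theory.

Local Open Scope classical_set_scope.
Local Open Scope ring_scope.

(* Groups given by generators and relations. A word over X is a sequence of
   letters; the letter (x, false) stands for x and (x, true) for x^-1. *)
Notation word X := (seq (X * bool)).

Definition letter_inv (X : Type) (l : X * bool) : X * bool := (l.1, ~~ l.2).
Definition word_inv (X : Type) (w : word X) : word X := rev (map (@letter_inv X) w).

(* [rels u v] is the relation "u = v". *)
Inductive pres_eq (X : Type) (rels : word X -> word X -> Prop) :
    word X -> word X -> Prop :=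
| pres_refl u : pres_eq rels u u
| pres_sym u v : pres_eq rels u v -> pres_eq rels v u
| pres_trans u v w : pres_eq rels u v -> pres_eq rels v w -> pres_eq rels u w
| pres_cat u u' v v' :
    pres_eq rels u u' -> pres_eq rels v v' -> pres_eq rels (u ++ v) (u' ++ v')
| pres_cancel l : pres_eq rels [:: l; letter_inv l] [::]
| pres_rel u v : rels u v -> pres_eq rels u v.

Section PresentedGroup.
Variables (X : choiceType) (rels : word X -> word X -> Prop).

Definition pres_eqb : rel (word X) := fun u v => `[< pres_eq rels u v >].

Lemma pres_eqb_equiv : equiv_class_of pres_eqb.
Proof.
split=> [u|u v|v u w].
- exact/asboolP/pres_refl.
- by apply/asboolP/asboolP; exact: pres_sym.
- by move=> /asboolP uv /asboolP vw; apply/asboolP; exact: pres_trans uv vw.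
Qed.

Canonical pres_equiv := EquivRelPack pres_eqb_equiv.

Local Open Scope quotient_scope.

Definition presented := {eq_quot pres_equiv}.

HB.instance Definition _ := Choice.on presented.
HB.instance Definition _ := Quotient.on presented.

Definition word_class (w : word X) : presented := \pi_presented w.

Lemma word_classE u v : word_class u = word_class v <-> pres_eq rels u v.
Proof.
split=> [/eqmodP/asboolP //|uv].
by apply/eqmodP/asboolP.
Qed.

Lemma word_classK (g : presented) : word_class (repr g) = g.
Proof. exact: reprK. Qed.

Lemma pres_repr u : pres_eq rels (repr (word_class u)) u.
Proof. by apply/word_classE; rewrite word_classK. Qed.

Definition pres_one : presented := word_class [::].
Definition pres_mul (g h : presented) : presented :=
  word_class (repr g ++ repr h).
Definition pres_inv (g : presented) : presented := word_class (word_inv (repr g)).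

Lemma pres_mulE u v : pres_mul (word_class u) (word_class v) = word_class (u ++ v).
Proof. by apply/word_classE; apply: pres_cat; exact: pres_repr. Qed.

Lemma pres_mulA : associative pres_mul.
Proof.
move=> g h k; rewrite -(word_classK g) -(word_classK h) -(word_classK k).
by rewrite !pres_mulE catA.
Qed.

Lemma pres_1mul : left_id pres_one pres_mul.
Proof. by move=> g; rewrite -(word_classK g) pres_mulE. Qed.

Lemma pres_mul1 : right_id pres_one pres_mul.
Proof. by move=> g; rewrite -(word_classK g) pres_mulE cats0. Qed.

Lemma letter_invK : involutive (@letter_inv X).
Proof. by case=> x b; rewrite /letter_inv /= negbK. Qed.

Lemma pres_catV u : pres_eq rels (u ++ word_inv u) [::].
Proof.
elim: u => [|l u IH]; first exact: pres_refl.
have -> : (l :: u) ++ word_inv (l :: u) =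
    [:: l] ++ ((u ++ word_inv u) ++ [:: letter_inv l]).
  by rewrite /word_inv /= rev_cons -cats1 catA.
apply: (pres_trans _ (pres_cancel rels l)).
apply: (pres_cat (u' := [:: l]) (v' := [::] ++ [:: letter_inv l])).
  exact: pres_refl.
by apply: pres_cat => //; exact: pres_refl.
Qed.

Lemma word_invK (u : word X) : word_inv (word_inv u) = u.
Proof.
rewrite /word_inv map_rev revK -map_comp.
by rewrite (eq_map (g := id)) ?map_id// => l /=; rewrite letter_invK.
Qed.

Lemma pres_mulV : right_inverse pres_one pres_inv pres_mul.
Proof.
move=> g; rewrite -{1}(word_classK g) pres_mulE.
by apply/word_classE; exact: pres_catV.
Qed.

Lemma pres_Vmul : left_inverse pres_one pres_inv pres_mul.
Proof.
move=> g; rewrite -{2}(word_classK g) pres_mulE.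
by apply/word_classE; rewrite -{2}(word_invK (repr g)); exact: pres_catV.
Qed.

HB.instance Definition _ :=
  isGroup.Build presented pres_mulA pres_1mul pres_mul1 pres_Vmul pres_mulV.

Definition pres_gen (x : X) : presented := word_class [:: (x, false)].

End PresentedGroup.

(* BS(1,2) = < a, t | t a t^-1 = a^2 > *)
Inductive bs_letter := BSa | BSt.

Definition bs_letter_bool (x : bs_letter) : bool := if x is BSt then true else false.
Definition bool_bs_letter (b : bool) : bs_letter := if b then BSt else BSa.
Lemma bs_letter_boolK : cancel bs_letter_bool bool_bs_letter.
Proof. by case. Qed.
HB.instance Definition _ := Choice.copy bs_letter (can_type bs_letter_boolK).

Inductive BS12_rel : word bs_letter -> word bs_letter -> Prop :=
| BS12_relator :
    BS12_rel [:: (BSt, false); (BSa, false); (BSt, true)]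
             [:: (BSa, false); (BSa, false)].

Definition BS12 : groupType := presented BS12_rel.
Definition BS12_a : BS12 := pres_gen BS12_rel BSa.
Definition BS12_t : BS12 := pres_gen BS12_rel BSt.
Definition BS12_gens : seq BS12 := [:: BS12_a; BS12_a^-1; BS12_t; BS12_t^-1]%g.

Lemma BS12_gens_generate (g : BS12) :
  exists2 w : seq BS12, {subset w <= BS12_gens} & g = (\prod_(s <- w) s)%g.
Proof.
have eqV x : (pres_gen BS12_rel x)^-1%g = word_class BS12_rel [:: (x, true)].
  apply: (@mulgI _ (pres_gen BS12_rel x)); rewrite mulgV [RHS]pres_mulE.
  by apply/esym/word_classE; exact: pres_catV.
rewrite -(word_classK g); elim: (repr g) => [|l u [w wA E]].
  by exists [::] => //; rewrite big_nil.
exists (word_class BS12_rel [:: l] :: w).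
  move=> s; rewrite inE => /orP[/eqP->|/wA//].
  by case: l => -[] [] ; rewrite -?eqV !inE eqxx ?orbT.
rewrite big_cons -E; exact: esym (pres_mulE BS12_rel [:: l] u).
Qed.

(* The Cayley graph of (G, A) as a metric graph. *)
Section CayleyGraph.
Variables (R : realType) (G : groupType) (A : seq G).

Definition cayley_adj (g h : G) : Prop :=
  g <> h /\ exists2 s, s \in A & (h = g * s \/ g = h * s)%g.

(* Points are given by barycentric coordinates on the vertices, so that the
   edges {g, h} and {h, g} are the same segment and edges are glued exactly
   along their common vertices. *)
Definition vertex (g : G) : G -> R := fun k => (k == g)%:R.

Definition edge_point (g h : G) (x : R) : G -> R :=
  fun k => (1 - x) * vertex g k + x * vertex h k.

Definition cayley_graph : set (G -> R) :=
  [set p | (exists g, p = vertex g) \/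
           exists g h x, [/\ cayley_adj g h, 0 <= x <= 1 & p = edge_point g h x]].

(* [pl_path D p q l]: some piecewise linear path of length l goes from p to q
   inside D; each piece runs along one edge, from parameter x to parameter y. *)
Inductive pl_path (D : set (G -> R)) : (G -> R) -> (G -> R) -> R -> Prop :=
| pl_nil p : D p -> pl_path D p p 0
| pl_cons g h (x y : R) q l :
    cayley_adj g h -> 0 <= x <= 1 -> 0 <= y <= 1 ->
    (forall z : R, Num.min x y <= z <= Num.max x y -> D (edge_point g h z)) ->
    pl_path D (edge_point g h y) q l ->
    pl_path D (edge_point g h x) q (`|x - y| + l).

(* The path metric; it is +oo between points not joined by a path, which does
   not happen when A generates G. *)
Definition cayley_dist (p q : G -> R) : \bar R :=
  ereal_inf [set l%:E | l in pl_path cayley_graph p q].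

Definition cayley_sphere (r : R) : set (G -> R) :=
  [set p | cayley_graph p /\ cayley_dist (vertex 1%g) p = r%:E].

(* Both endpoints of an edge may lie in the ball of integral radius r without
   the interior of the edge being contained in it. *)
Definition cayley_ball (r : R) : set (G -> R) :=
  [set p | cayley_graph p /\ (cayley_dist (vertex 1%g) p <= r%:E)%E].

Definition almost_convex (f : nat -> R) (r0 : nat) : Prop :=
  forall r : nat, (r0 <= r)%N -> forall a b : G,
    cayley_sphere r%:R (vertex a) -> cayley_sphere r%:R (vertex b) ->
    (cayley_dist (vertex a) (vertex b) <= 2%:E)%E ->
    exists2 l : R, pl_path (cayley_ball r%:R) (vertex a) (vertex b) l & l <= f r.

End CayleyGraph.

Definition sublinear (R : realType) (f : nat -> R) : Prop :=
  forall C : R, 0 < C -> (fun r : nat => r%:R - C * f r) @ \oo --> +oo.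

Definition poenaru_P2 (R : realType) (G : groupType) (A : seq G) : Prop :=
  exists (f : nat -> R) (r0 : nat),
    [/\ forall n, 0 <= f n, sublinear f & almost_convex A f r0].

(* Main.v *)
From HB Require Import structures.
Require Import Defs.
From mathcomp Require Import all_boot all_order all_algebra.
From mathcomp Require Import all_classical all_reals all_analysis.
From mathcomp Require Import zify ring lra.

(* Write elements of BS(1,2) as affine maps, a = (1, 0) and t = (0, 1), where
   (x, m) stands for y |-> 2^m y + x; m is the level. Put s = q + 2 and
   w = (2^s + 1/2, 0). A path from 1 to a vertex (x, 0) with x not an integer
   must visit level -1, use a letter a^+-1 there, and cross every level between
   0 and its maximum twice; counting letters, length at most 2s + 2 forces
   |x| <= 3/4 2^s + 1/2. Hence |w| = 2s + 3, while both w t and w t^-1 have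
   length r = 2s + 2: the letter of level -1 can be used after or before the
   climb to level s - 1. A path in B(r) from w t to w t^-1 has to leave the
   branch above w through a vertex (x, 0) of B(r) with x not an integer. As such
   an x is at distance at least 2^(s-2) from 2^s + 1/2, and n letters starting
   at level 1 change x by at most 2^(n+1), the path has length at least s - 3,
   which is linear in r. *)

Set Implicit Arguments.
Unset Strict Implicit.
Unset Printing Implicit Defensive.
Import Order.TTheory GRing.Theory Num.Theory.

Local Open Scope classical_set_scope.
Local Open Scope ring_scope.

(** * Edge paths and piecewise linear paths *)

Section EdgePaths.
Variables (G : groupType) (A : seq G).

Inductive edge_path (P : G -> Prop) : nat -> G -> G -> Prop :=
| edge_path0 g : P g -> edge_path P 0 g g
| edge_pathS n g h k :
    P g -> cayley_adj A g h -> edge_path P n h k -> edge_path P n.+1 g k.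

Lemma edge_path_cat P m n g h k :
  edge_path P m g h -> edge_path P n h k -> edge_path P (m + n) g k.
Proof.
elim=> // {}m {}g g' {}h Pg gg' _ IH hk; rewrite addSn.
exact: edge_pathS gg' (IH hk).
Qed.

Lemma cayley_adj_sym g h : cayley_adj A g h -> cayley_adj A h g.
Proof.
by case=> gh [s sA sE]; split; [exact/nesym | exists s => //; case: sE; auto].
Qed.

Lemma cayley_adj_gen g s : s \in A -> s <> 1%g -> cayley_adj A g (g * s)%g.
Proof.
move=> sA s1; split; last by exists s => //; left.
by rewrite -{1}(mulg1 g) => /mulgI /esym.
Qed.

Lemma edge_path_expg g s n : s \in A -> s <> 1%g ->
  edge_path xpredT n g (g * s ^+ n)%g.
Proof.
move=> sA s1; elim: n g => [|n IH] g; first by rewrite expg0 mulg1; exact: edge_path0.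
rewrite expgS mulgA; apply: edge_pathS (IH _) => //.
exact: cayley_adj_gen.
Qed.

Variable R : realType.

Lemma edge_point0 (g h : G) : edge_point g h 0 = vertex R g.
Proof. by apply/funext => k; rewrite /edge_point subr0 mul1r mul0r addr0. Qed.

Lemma edge_point1 (g h : G) : edge_point g h 1 = vertex R h.
Proof. by apply/funext => k; rewrite /edge_point subrr mul1r mul0r add0r. Qed.

Lemma edge_pointE (g h : G) (x : R) (k : G) : g <> h ->
  edge_point g h x k = if k == g then 1 - x else if k == h then x else 0 :> R.
Proof.
move=> /eqP gh; rewrite /edge_point /vertex.
have [->|_] := eqVneq k g; first by rewrite (negbTE gh) /=; ring.
by case: (k == h); rewrite /=; ring.
Qed.

Lemma pl_path_edge_path n g h : edge_path xpredT n g h ->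
  pl_path A (cayley_graph A) (vertex R g) (vertex R h) n%:R.
Proof.
elim=> {n g h} [g _|n g h k _ gh _ IH]; first by apply: pl_nil; left; exists g.
have -> : n.+1%:R = `|0 - 1| + n%:R :> R by rewrite sub0r normrN1 -natr1 addrC.
rewrite -(edge_point0 g h); apply: pl_cons => //; rewrite ?lexx ?ler01 //.
  move=> z; rewrite min_l ?max_r ?ler01 // => z01.
  by right; exists g, h, z.
by rewrite edge_point1.
Qed.

(* [1 - p v] is the distance from [p] to the end [v] of an edge containing [p]. *)
Lemma edge_path_pl_path D p k l : pl_path A D p (vertex R k) l ->
  exists v n, [/\ 0 < p v, edge_path (fun g => D (vertex R g)) n v k
                & 1 - p v + n%:R <= l].
Proof.
move E: (vertex R k) => q pq; elim: pq E => {p q l}.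
  move=> p Dp E; subst p; exists k, 0%N; rewrite /vertex eqxx subrr addr0.
  by split=> //; exact: edge_path0.
move=> g h x y q l gh x01 y01 Dz _ IH /IH[v [n [yv vk nl]]].
have [gNh _] := gh.
have Dx : D (edge_point g h x).
  by apply: Dz; rewrite ge_min lexx le_max lexx.
have nxy : x - y <= `|x - y| /\ y - x <= `|x - y|.
  by split; [exact: ler_norm | rewrite distrC ler_norm].
move: yv nl; rewrite !edge_pointE //.
have [vg|_] := eqVneq v g; last have [vh|_] := eqVneq v h; last by rewrite ltxx.
(* At [x = 1] the coordinate at [g] vanishes: the piece starts at the vertex [h], and the edge from
   [h] to [g] is added to the edge path. *)
- move=> _ nl; subst v; have [x1|x1] := eqVneq x 1.
    exists h, n.+1; rewrite !edge_pointE // eqxx; move/eqP/negbTE: (nesym gNh) => ->.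
    split; first by rewrite x1.
      apply: edge_pathS vk; first by rewrite -(edge_point1 g) -x1.
      exact: cayley_adj_sym.
    by rewrite -natr1; lra.
  exists g, n; rewrite !edge_pointE // eqxx; split=> //; last by lra.
  by rewrite subr_gt0 lt_neqAle x1; case/andP: x01.
- move=> _ nl; subst v; have [x0|x0] := eqVneq x 0.
    exists g, n.+1; rewrite !edge_pointE // eqxx.
    split; first by rewrite x0 subr0.
      by apply: edge_pathS vk => //; rewrite -(edge_point0 g h) -x0.
    by rewrite -natr1; lra.
  exists h, n; rewrite !edge_pointE // eqxx; move/eqP/negbTE: (nesym gNh) => ->.
  split=> //; last by lra.
  by rewrite lt_neqAle eq_sym x0; case/andP: x01.
Qed.

Lemma edge_path_vertices D g k l : pl_path A D (vertex R g) (vertex R k) l ->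
  exists2 n, edge_path (fun v => D (vertex R v)) n g k & n%:R <= l.
Proof.
move=> /edge_path_pl_path[v [n []]]; rewrite /vertex.
have [->|_] := eqVneq v g; last by rewrite ltxx.
by move=> _ gk; rewrite subrr add0r; exists n.
Qed.

Lemma edge_pathW P Q n g h : (forall v, P v -> Q v) ->
  edge_path P n g h -> edge_path Q n g h.
Proof.
move=> PQ; elim=> {n g h} [g /PQ|n g h k /PQ Pg gh _ IH]; first exact: edge_path0.
exact: edge_pathS gh IH.
Qed.

Lemma cayley_dist_le n g h : edge_path xpredT n g h ->
  (cayley_dist A (vertex R g) (vertex R h) <= n%:R%:E)%E.
Proof.
by move=> gh; apply: ereal_inf_lbound; exists n%:R => //; exact: pl_path_edge_path.
Qed.

Lemma cayley_dist_ge n g h : (forall m, edge_path xpredT m g h -> (n <= m)%N) ->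
  (n%:R%:E <= cayley_dist A (vertex R g) (vertex R h))%E.
Proof.
move=> nP; apply: le_ereal_inf_tmp => _ [l /edge_path_vertices[m gh ml] <-].
rewrite lee_fin; apply: le_trans ml; rewrite ler_nat; apply: nP.
exact: edge_pathW gh.
Qed.

(** Edge paths have integral length: if each of them had more than [n] edges, the infimum would be
    at least [n + 1]. *)
Lemma cayley_dist_leP n g h :
  (cayley_dist A (vertex R g) (vertex R h) <= n%:R%:E)%E ->
  exists2 m, edge_path xpredT m g h & (m <= n)%N.
Proof.
move=> gh; apply: contrapT => N; suff : (n.+1%:R%:E <= n%:R%:E :> \bar R)%E.
  by rewrite lee_fin ler_nat ltnn.
apply: le_trans gh; apply: cayley_dist_ge => m gh; rewrite leqNgt.
by apply/negP => mn; apply: N; exists m.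
Qed.

End EdgePaths.

(** * The affine normal form *)

(** Right multiplication by a letter in affine coordinates: composing [y |-> 2^m y + x] with
    [y |-> y + 1] on the inside moves [x] by [2^m]. *)
Definition bs_act1 (p : rat * int) (l : bs_letter * bool) : rat * int :=
  match l with
  | (BSa, false) => (p.1 + 2 ^ p.2, p.2)
  | (BSa, true) => (p.1 - 2 ^ p.2, p.2)
  | (BSt, false) => (p.1, p.2 + 1)
  | (BSt, true) => (p.1, p.2 - 1)
  end.

Lemma exp2zD1 (m : int) : 2 ^ (m + 1) = 2 * 2 ^ m :> rat.
Proof. by rewrite expfzDr // expr1z mulrC. Qed.

(** Quantifying over the start [p] lets the congruence case compose; the relator amounts to
    [2^(m+1) = 2^m + 2^m]. *)
Lemma bs_act_pres u v : pres_eq BS12_rel u v ->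
  forall p, foldl bs_act1 p u = foldl bs_act1 p v.
Proof.
elim=> {u v} // [u v w _ uv _ vw p|u u' v v' _ uu _ vv p|[[] []] [x m]|_ _ [] [x m]] //=.
- by rewrite uv.
- by rewrite !foldl_cat uu vv.
- by rewrite subrK.
- by rewrite addrK.
- by rewrite subrK.
- by rewrite addrK.
- by rewrite addrK exp2zD1; congr pair; ring.
Qed.

(* The normal form [(x, m)] of [a^x t^m], that is of the affine map
   [y |-> 2^m y + x]. *)
Definition bs_affine (g : BS12) : rat * int := foldl bs_act1 (0, 0) (repr g).

Lemma bs_affine_class w : bs_affine (word_class BS12_rel w) = foldl bs_act1 (0, 0) w.
Proof. exact/bs_act_pres/pres_repr. Qed.

Lemma bs_affine1 : bs_affine 1%g = (0, 0).
Proof. exact: bs_affine_class. Qed.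

Lemma bs_affineM_gen g x :
  bs_affine (g * pres_gen BS12_rel x)%g = bs_act1 (bs_affine g) (x, false).
Proof.
rewrite -(word_classK g) [(_ * _)%g]pres_mulE !bs_affine_class.
by rewrite foldl_cat.
Qed.

Lemma bs_affineMa g :
  bs_affine (g * BS12_a)%g = ((bs_affine g).1 + 2 ^ (bs_affine g).2, (bs_affine g).2).
Proof. exact: bs_affineM_gen. Qed.

Lemma bs_affineMt g :
  bs_affine (g * BS12_t)%g = ((bs_affine g).1, (bs_affine g).2 + 1).
Proof. exact: bs_affineM_gen. Qed.

Lemma bs_affineMtX g n :
  bs_affine (g * BS12_t ^+ n)%g = ((bs_affine g).1, (bs_affine g).2 + n%:Z).
Proof.
elim: n => [|n IH]; first by rewrite expg0 mulg1 addr0; case: bs_affine.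
by rewrite expgSr mulgA bs_affineMt IH /=; congr pair; lia.
Qed.

Lemma bs_affineMtVX g n :
  bs_affine (g * BS12_t ^- n)%g = ((bs_affine g).1, (bs_affine g).2 - n%:Z).
Proof.
have := bs_affineMtX (g * BS12_t ^- n)%g n; rewrite mulgVK.
by case: (bs_affine (g * BS12_t ^- n)%g) => x m -> /=; congr pair; lia.
Qed.

Variant bs_step (x : rat) (m : int) : rat -> int -> Prop :=
| bs_step_a (e : bool) : bs_step x m (x + (-1) ^+ e * 2 ^ m) m
| bs_step_t (e : bool) : bs_step x m x (m + (-1) ^+ e).

Lemma bs_step_sym x m x' m' : bs_step x m x' m' -> bs_step x' m' x m.
Proof.
case=> e.
- by rewrite -{2}(addrK ((-1) ^+ e * 2 ^ m) x) -mulNr -signrN; constructor.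
- by rewrite -{2}(addrK ((-1) ^+ e) m) -signrN; constructor.
Qed.

Definition bs_stepg g h :=
  bs_step (bs_affine g).1 (bs_affine g).2 (bs_affine h).1 (bs_affine h).2.

Lemma bs_stepg_adj g h : cayley_adj BS12_gens g h -> bs_stepg g h.
Proof.
have stepa k : bs_stepg k (k * BS12_a)%g.
  rewrite /bs_stepg bs_affineMa -[2 ^ _ in X in bs_step _ _ X]mul1r.
  exact: (bs_step_a _ _ false).
have stept k : bs_stepg k (k * BS12_t)%g.
  by rewrite /bs_stepg bs_affineMt; exact: (bs_step_t _ _ false).
have step k s : s \in BS12_gens -> bs_stepg k (k * s)%g.
  rewrite !inE => /or4P[] /eqP-> //; apply: bs_step_sym.
    by rewrite -{3 4}(mulgVK BS12_a k); exact: stepa.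
  by rewrite -{3 4}(mulgVK BS12_t k); exact: stept.
case=> _ [s sA [->|->]]; first exact: step.
exact/bs_step_sym/step.
Qed.

(** * Lengths of half-integral elements of level 0 *)

Lemma exp2z_gt0 (m : int) : 0 < 2 ^ m :> rat.
Proof. exact: exprz_gt0. Qed.

Lemma exp2z_int (m : int) : 0 <= m -> (2 ^ m : rat) \is a Num.int.
Proof. by case: m => // n _; rewrite -exprnP rpredX. Qed.

Lemma bs_step_int x m x' m' : 0 <= m -> bs_step x m x' m' ->
  (x' \is a Num.int) = (x \is a Num.int).
Proof.
by move=> m0 [] // e; rewrite rpredDr // rpredMsign exp2z_int.
Qed.

(* [n] letters lead from [(0, 0)] to [(x, m)]: [T] of them are [t^+-1] and [c]
   (resp. [d]) are [a^+-1] used at a level [>= 0] (resp. [< 0]); [M] is the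
   maximal level. The cases are: no level [< 0] was visited; one was, but the
   path came back; the path is now at such a level. *)
Definition bs_budget (n : nat) (x : rat) (m : int) : Prop :=
  exists M c d T : nat,
  [/\ n = (T + c + d)%N, m <= M%:Z, `|x| <= c%:R * 2 ^+ M + d%:R / 2,
      d = 0%N -> x \is a Num.int
    & [\/ [/\ d = 0%N, 0 <= m & (2 * M)%:Z <= T%:Z + m],
          0 <= m /\ (2 * M + 2)%:Z <= T%:Z + m
        | m < 0 /\ (2 * M)%:Z <= T%:Z + m]].

Lemma exp2z_le (m : int) (M : nat) : m <= M%:Z -> 2 ^ m <= 2 ^+ M :> rat.
Proof. by move=> mM; rewrite exprnP ler_eXz2l. Qed.

(** A step down leaves [T + m] fixed and a step up adds 2 to it. This gain pays either for a new
    maximum, where [2 * M] grows by 2, or for the return from level -1 to level 0, where the bound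
    rises from [2 * M] to [2 * M + 2]. *)
Lemma bs_budget_step n x m x' m' :
  bs_step x m x' m' -> bs_budget n x m -> bs_budget n.+1 x' m'.
Proof.
move=> st [M [c [d [T [nE mM xM dx cases]]]]]; case: st => e.
  have norm_le : `|x + (-1) ^+ e * 2 ^ m| <= `|x| + 2 ^ m.
    by apply: le_trans (ler_normD _ _) _; rewrite normrMsign (gtr0_norm (exp2z_gt0 m)).
  have [m0|m0] := leP 0 m.
    exists M, c.+1, d, T; split=> //; first by lia.
    - have := exp2z_le mM; rewrite -(natr1 c); lra.
    - by move=> /dx xint; rewrite rpredD // rpredMsign exp2z_int.
  exists M, c, d.+1, T; split=> //; first by lia.
  - have : 2 ^ m <= 2 ^ (-1) :> rat by rewrite ler_eXz2l //; lia.
    by rewrite -(natr1 d) exprN1; lra.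
  - by case: cases => -[]; [lia|lia|move=> _ ?; apply: Or33].
have [mM'|mM'] := leP (m + (-1) ^+ e) M%:Z.
  exists M, c, d, T.+1; split=> //; first by lia.
  case: e mM' => /=; rewrite ?expr0 ?expr1 => mM'.
  - have [m0|m0] := leP 0 (m - 1).
      by case: cases => -[];
        [move=> *; apply: Or31; split; lia | move=> *; apply: Or32; split; lia | lia].
    by apply: Or33; split=> //; case: cases => -[]; lia.
  - have [m0|m0] := leP 0 (m + 1).
      have [m1|m1] := leP 0 m; last by apply: Or32; case: cases => -[]; lia.
      by case: cases => -[];
        [move=> *; apply: Or31; split; lia | move=> *; apply: Or32; split; lia | lia].
    by apply: Or33; split=> //; case: cases => -[]; lia.
case: e mM' => /=; rewrite ?expr0 ?expr1 => mM'; first by lia.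
exists M.+1, c, d, T.+1; split=> //; first by lia.
- by lia.
- apply: le_trans xM _; rewrite lerD2r ler_wpM2l ?ler0n// ler_weXn2l //.
by case: cases => -[];
        [move=> *; apply: Or31; split; lia | move=> *; apply: Or32; split; lia | lia].
Qed.

Lemma bs_budget_path n g h : edge_path BS12_gens xpredT n g h ->
  forall k, bs_budget k (bs_affine g).1 (bs_affine g).2 ->
  bs_budget (k + n) (bs_affine h).1 (bs_affine h).2.
Proof.
elim=> {n g h} [g _ k|n g h v _ /bs_stepg_adj gh _ IH k gk]; first by rewrite addn0.
by rewrite addnS -addSn; apply: IH; exact: bs_budget_step gh gk.
Qed.

(** Equality at [k = 1] makes 3/4 the best constant in [2 k + 1 <= 3/4 * 2^(k+1)]. *)
Lemma exp2_ge_linear (k : nat) : (4 * (2 * k + 1) <= 3 * 2 ^ k.+1)%N.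
Proof.
elim: k => // -[//|k] IH; have : (2 <= 2 ^ k.+1)%N by rewrite (leq_exp2l 1).
by move: IH; rewrite !expnS; lia.
Qed.

(** Since [x] is not an integer, [d >= 1] and [T >= 2 M + 2], which leaves at most [2 (s - M)]
    letters [a^+-1]. As [2^M > 1/2], the bound on [|x|] is largest when only one of them is used
    below level 0. *)
Lemma bs_norm_le s n g x : (n <= 2 * s + 2)%N ->
  edge_path BS12_gens xpredT n 1%g g -> bs_affine g = (x, 0) ->
  x \isn't a Num.int -> `|x| <= 3 / 4 * 2 ^+ s + 1 / 2.
Proof.
move=> ns /bs_budget_path/(_ 0%N); rewrite bs_affine1 => + gE.
rewrite gE /= => H xint; have [|M [c [d [T []]]]] := H.
  exists 0%N, 0%N, 0%N, 0%N; split=> //; rewrite ?normr0 ?mul0r ?addr0 //.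
  by apply: Or31.
rewrite add0n => nE _ xM dx cases.
have d0 : (0 < d)%N by rewrite lt0n; apply: contra xint => /eqP/dx.
have T2 : (2 * M + 2 <= T)%N by case: cases => -[]; lia.
have Ms : (M < s)%N by lia.
pose k := (s - M - 1)%N; have cd : (c + d <= 2 * k + 2)%N by rewrite /k; lia.
have sE : s = (M + k.+1)%N by rewrite /k; lia.
have M1 : 1 <= 2 ^+ M :> rat by rewrite exprn_ege1.
have kk : 4 * (2 * k%:R + 1) <= 3 * 2 ^+ k.+1 :> rat.
  by have := exp2_ge_linear k; rewrite -(ler_nat rat) !natrM natrD natrM natrX.
have cd' : c%:R <= 2 * k%:R + 2 - d%:R :> rat.
  by rewrite lerBrDr -natrM -!natrD ler_nat.
have d1 : 1 <= d%:R :> rat by rewrite ler1n.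
rewrite sE exprD; nra.
Qed.

(** A first letter [a^+-1] adds [2^m] to the bound [2^(m+n)] for the rest, hence at most doubles it;
    a first letter [t^+-1] raises the level by at most one. *)
Lemma bs_norm_sub_le P n g h : edge_path BS12_gens P n g h ->
  `|(bs_affine g).1 - (bs_affine h).1| <= 2 ^ ((bs_affine g).2 + n%:Z).
Proof.
elim=> {n g h} [g _|n g h k _ /bs_stepg_adj]; first by rewrite subrr normr0 exprz_ge0.
rewrite /bs_stepg; case: (bs_affine g) (bs_affine h) => x m [x' m'] /= st _.
have le2 j : m' + n%:Z <= j -> 2 ^ (m' + n%:Z) <= 2 ^ j :> rat by rewrite ler_eXz2l.
case: st le2 => e le2 IH; last first.
  by apply: le_trans IH (le2 _ _); case: e {le2}; rewrite ?expr0 ?expr1; lia.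
have -> : m + n.+1%:Z = m + n%:Z + 1 by lia.
rewrite exp2zD1.
apply: le_trans (ler_distD (x + (-1) ^+ e * 2 ^ m) _ _) _.
rewrite opprD addNKr normrN normrMsign (gtr0_norm (exp2z_gt0 m)).
have : 2 ^ m <= 2 ^ (m + n%:Z) :> rat by rewrite ler_eXz2l //; lia.
lra.
Qed.

(* The cosets of <a> form a tree with levels, so the way down out of the branch
   above [g] goes through level 0; steps at levels [>= 0] do not change [x]
   modulo 1. *)
Lemma edge_path_through_level0 P n g h : edge_path BS12_gens P n g h ->
  0 <= (bs_affine g).2 -> (bs_affine h).2 < 0 ->
  (bs_affine g).1 \isn't a Num.int ->
  exists2 v, P v & exists2 m, (m <= n)%N &
    [/\ edge_path BS12_gens P m g v, (bs_affine v).1 \isn't a Num.int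
       & (bs_affine v).2 = 0].
Proof.
elim=> {n g h} [g _|n g h k Pg gh hk IH] g0 k0 gint; first by rewrite ltNge g0 in k0.
have [g1|g1] := eqVneq (bs_affine g).2 0.
  by exists g => //; exists 0%N => //; split=> //; exact: edge_path0.
have st := bs_stepg_adj gh.
have h0 : 0 <= (bs_affine h).2.
  move: st; rewrite /bs_stepg; case: (bs_affine g) g0 g1 => x m /= m0 m1.
  by case=> // -[]; rewrite ?expr0 ?expr1; lia.
have hint : (bs_affine h).1 \isn't a Num.int by rewrite (bs_step_int g0 st).
have [v Pv [m mn [hv vint v0]]] := IH h0 k0 hint.
exists v => //; exists m.+1 => //; split=> //; exact: edge_pathS gh hv.
Qed.

(** * Two close vertices of the sphere of radius 2q + 6 *)

Lemma BS12_relation : (BS12_t * BS12_a * BS12_t^-1 = BS12_a ^+ 2)%g.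
Proof.
apply: (mulIg BS12_t); rewrite mulgVK expg2.
have -> : (BS12_t * BS12_a)%g = word_class BS12_rel [:: (BSt, false); (BSa, false)].
  exact: pres_mulE.
have -> : (BS12_a * BS12_a * BS12_t)%g =
    word_class BS12_rel ([:: (BSa, false); (BSa, false)] ++ [:: (BSt, false)]).
  by rewrite -pres_mulE -(pres_mulE _ [:: (BSa, false)] [:: (BSa, false)]).
apply/word_classE.
apply: (@pres_trans _ _ _ ([:: (BSt, false); (BSa, false); (BSt, true)] ++ [:: (BSt, false)])).
  apply: (@pres_cat _ _ [:: (BSt, false); (BSa, false)] [:: (BSt, false); (BSa, false)]
    [::] [:: (BSt, true); (BSt, false)]); first exact: pres_refl.
  exact/pres_sym/(pres_cancel _ (BSt, true)).
by apply: pres_cat; [exact/pres_rel/BS12_relator|exact: pres_refl].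
Qed.

Lemma BS12_conj_expg n : (BS12_t ^+ n * BS12_a * BS12_t ^- n = BS12_a ^+ (2 ^ n))%g.
Proof.
elim: n => [|n IH]; first by rewrite expg0 invg1 mul1g mulg1.
have -> : (BS12_t ^+ n.+1 * BS12_a * BS12_t ^- n.+1 =
    BS12_t ^+ n * (BS12_t * BS12_a * BS12_t^-1) * BS12_t ^- n)%g.
  by rewrite expgSr invgM !mulgA.
rewrite BS12_relation expg2 !mulgA.
have -> : (BS12_t ^+ n * BS12_a * BS12_a * BS12_t ^- n =
  (BS12_t ^+ n * BS12_a * BS12_t ^- n) * (BS12_t ^+ n * BS12_a * BS12_t ^- n))%g.
  by rewrite !mulgA mulgVK.
by rewrite IH -expgnDr addnn -mul2n expnS.
Qed.

Lemma BS12_a_neq1 : BS12_a <> 1%g.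
Proof.
by move/(congr1 (fun g => bs_affine (1 * g)%g)); rewrite bs_affineMa mulg1 bs_affine1.
Qed.

Lemma BS12_t_neq1 : BS12_t <> 1%g.
Proof.
by move/(congr1 (fun g => bs_affine (1 * g)%g)); rewrite bs_affineMt mulg1 bs_affine1.
Qed.

(* Two geodesics from 1 to the neighbours of [bs_mid q], the element
   [(2^(q+2) + 1/2, 0)]: the first one climbs before it uses the letter of
   level -1 and arrives from below, the second one does it afterwards and
   arrives from above. *)
Definition bs_low q : BS12 :=
  (BS12_t ^+ q.+1 * BS12_a ^+ 2 * BS12_t ^- q.+2 * BS12_a)%g.
Definition bs_mid q : BS12 := (bs_low q * BS12_t)%g.
Definition bs_high q : BS12 := (bs_mid q * BS12_t)%g.

(** Multiplied by [t] on the left, both words become the product of [t^(q+3) a t^-(q+3)] and [a], in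
    opposite orders, followed by [t^2]. The two factors commute because the first is a power of
    [a]. *)
Lemma bs_highE q : bs_high q =
  (BS12_t^-1 * BS12_a * BS12_t ^+ q.+2 * BS12_a ^+ 2 * BS12_t ^- q)%g.
Proof.
have C : commute (BS12_t ^+ q.+3 * BS12_a * BS12_t ^- q.+3)%g BS12_a.
  by rewrite BS12_conj_expg; exact/commute_sym/commuteX.
apply: (mulgI BS12_t); rewrite /bs_high /bs_mid /bs_low -BS12_relation.
transitivity (BS12_t ^+ q.+3 * BS12_a * BS12_t ^- q.+3 * BS12_a * BS12_t * BS12_t)%g.
  have {1}-> : (BS12_t ^+ q.+3 = BS12_t * BS12_t ^+ q.+1 * BS12_t)%g.
    by rewrite expgSr expgS.
  have -> : (BS12_t ^- q.+3 = BS12_t^-1 * BS12_t ^- q.+2)%g by rewrite expgSr invgM.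
  by rewrite !mulgA.
have EV : (BS12_t ^- q.+3 = BS12_t^-1 * BS12_t ^- q * BS12_t^-1 * BS12_t^-1)%g.
  by rewrite 2!expgS expgSr !invgM.
by rewrite C EV expgSr !mulgA mulgV mul1g !mulgVK.
Qed.

Lemma bs_affine_low q : bs_affine (bs_low q) = (2 ^+ q.+2 + 1 / 2, -1).
Proof.
rewrite /bs_low bs_affineMa bs_affineMtVX expg2 mulgA !bs_affineMa.
rewrite -[(BS12_t ^+ _)%g]mul1g bs_affineMtX bs_affine1 /=.
have -> : 0 + q.+1%:Z - q.+2%:Z = -1 by lia.
by rewrite !add0r exprN1 -exprnP !exprS; congr pair; ring.
Qed.

Lemma bs_affine_mid q : bs_affine (bs_mid q) = (2 ^+ q.+2 + 1 / 2, 0).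
Proof. by rewrite bs_affineMt bs_affine_low. Qed.

Lemma bs_affine_high q : bs_affine (bs_high q) = (2 ^+ q.+2 + 1 / 2, 1).
Proof. by rewrite bs_affineMt bs_affine_mid. Qed.

Lemma half_nint q : (2 ^+ q.+2 + 1 / 2 : rat) \isn't a Num.int.
Proof. by rewrite rpredDl ?rpredX. Qed.

Lemma edge_path_expVg n g : edge_path BS12_gens xpredT n g (g * BS12_t ^- n)%g.
Proof.
rewrite -expVgn; apply: edge_path_expg; first by rewrite !inE eqxx !orbT.
by move/(congr1 (fun x => x^-1)%g); rewrite invgK invg1; exact: BS12_t_neq1.
Qed.

Lemma BS12_a_gen : BS12_a \in BS12_gens.
Proof. by rewrite inE eqxx. Qed.

Lemma BS12_t_gen : BS12_t \in BS12_gens.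
Proof. by rewrite !inE eqxx !orbT. Qed.

Lemma edge_path_expag n g : edge_path BS12_gens xpredT n g (g * BS12_a ^+ n)%g.
Proof. exact: edge_path_expg BS12_a_gen BS12_a_neq1. Qed.

Lemma edge_path_exptg n g : edge_path BS12_gens xpredT n g (g * BS12_t ^+ n)%g.
Proof. exact: edge_path_expg BS12_t_gen BS12_t_neq1. Qed.

Lemma edge_path_low q : edge_path BS12_gens xpredT (2 * q.+2 + 2) 1%g (bs_low q).
Proof.
have -> : (2 * q.+2 + 2 = q.+1 + 2 + q.+2 + 1)%N by lia.
apply: edge_path_cat (edge_path_expag 1 _).
apply: edge_path_cat (edge_path_expVg _ _).
apply: edge_path_cat (edge_path_expag _ _).
by rewrite -[X in edge_path _ _ _ _ X]mul1g; exact: edge_path_exptg.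
Qed.

Lemma edge_path_high q : edge_path BS12_gens xpredT (2 * q.+2 + 2) 1%g (bs_high q).
Proof.
have -> : (2 * q.+2 + 2 = 1 + 1 + q.+2 + 2 + q)%N by lia.
rewrite bs_highE; apply: edge_path_cat (edge_path_expVg _ _).
apply: edge_path_cat (edge_path_expag _ _).
apply: edge_path_cat (edge_path_exptg _ _).
apply: edge_path_cat (edge_path_expag 1 _).
by rewrite -[X in edge_path _ _ _ _ X]mul1g; exact: (edge_path_expVg 1).
Qed.

Lemma edge_path_mid_ge q n : edge_path BS12_gens xpredT n 1%g (bs_mid q) ->
  (2 * q.+2 + 2 < n)%N.
Proof.
move=> mid; rewrite ltnNge; apply/negP => nq.
have := bs_norm_le nq mid (bs_affine_mid q) (half_nint q).
have : 0 < 2 ^+ q.+2 :> rat by exact: exprn_gt0.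
move=> q0; rewrite ger0_norm; lra.
Qed.

Lemma cayley_adj_mid_high q : cayley_adj BS12_gens (bs_mid q) (bs_high q).
Proof. exact: cayley_adj_gen BS12_t_gen BS12_t_neq1. Qed.

Lemma cayley_adj_low_mid q : cayley_adj BS12_gens (bs_low q) (bs_mid q).
Proof. exact: cayley_adj_gen BS12_t_gen BS12_t_neq1. Qed.

Section Spheres.
Variable R : realType.

(** A shorter path to [g], extended by one edge, would reach [bs_mid q] too soon. *)
Lemma cayley_sphere_mid_adj q g :
  cayley_adj BS12_gens g (bs_mid q) ->
  edge_path BS12_gens xpredT (2 * q.+2 + 2) 1%g g ->
  cayley_sphere BS12_gens (2 * q.+2 + 2)%:R (vertex R g).
Proof.
move=> gm le; split; first by left; exists g.
apply/eqP; rewrite eq_le cayley_dist_le //=; apply: cayley_dist_ge => m mg.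
have := edge_path_cat mg (edge_pathS isT gm (edge_path0 _ isT)).
by move/edge_path_mid_ge; rewrite addn1 ltnS.
Qed.

Lemma bs_ball_path_ge q (l : R) :
  pl_path BS12_gens (cayley_ball BS12_gens (2 * q.+2 + 2)%:R)
    (vertex R (bs_high q)) (vertex R (bs_low q)) l ->
  q%:R - 1 <= l.
Proof.
move=> /edge_path_vertices[n hl nl]; apply: le_trans nl.
have [|||v [_ /cayley_dist_leP[k kv kq]] [m mn [hv vint v0]]] :=
  edge_path_through_level0 hl.
- by rewrite bs_affine_high.
- by rewrite bs_affine_low.
- by rewrite bs_affine_high half_nint.
have vE : bs_affine v = ((bs_affine v).1, 0) by rewrite -v0; case: (bs_affine v).
have := bs_norm_le kq kv vE vint; have := bs_norm_sub_le hv.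
rewrite bs_affine_high /= => H1 /ler_normlW H2.
have H3 := ler_normlW H1.
have q2 : 2 ^+ q.+2 = 4 * 2 ^+ q :> rat by rewrite !exprS; ring.
(* The halves cancel, and the quarter of [2 ^+ q.+2] that remains is [2 ^+ q]. *)
have : 2 ^ q%:Z <= 2 ^ (1 + m%:Z) :> rat by move: H2 H3; rewrite q2 -exprnP; lra.
rewrite ler_eXz2l // => qm.
by rewrite lerBlDr natr1 ler_nat; lia.
Qed.

End Spheres.

Theorem theorem4p3 (R : realType) : ~ poenaru_P2 R BS12_gens.
Proof.
move=> [f [r0 [_ sub AC]]].
(* With [r = 2 q + 6] and [f r >= q - 1], the difference [r - 2 * f r] is at most 8, hence [C = 2]
   and the bound 9. *)
have /cvgryPge/(_ 9)[N _ NP] := sub 2 (ltr0n _ 2).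
pose q := (r0 + N)%N; pose r := (2 * q.+2 + 2)%N.
have [||||l /bs_ball_path_ge ql lf] := AC r _ (bs_high q) (bs_low q).
- by rewrite /r /q; lia.
- apply: cayley_sphere_mid_adj (edge_path_high q).
  exact/cayley_adj_sym/cayley_adj_mid_high.
- exact: cayley_sphere_mid_adj (cayley_adj_low_mid q) (edge_path_low q).
- apply: (@cayley_dist_le _ _ _ 2).
  apply: edge_pathS (cayley_adj_sym (cayley_adj_mid_high q)) _ => //.
  apply: edge_pathS (cayley_adj_sym (cayley_adj_low_mid q)) _ => //.
  exact: edge_path0.
have /NP/= : (N <= r)%N by rewrite /r /q; lia.
have -> : r%:R = 2 * q%:R + 6 :> R by rewrite -natrM -natrD; congr _%:R; rewrite /r; lia.
lra.
Qed.
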